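(* Let $(D,\mathfrak{S})$ be a summation on a ring $R$ to an $R$-algebra $E$. If $\mathfrak{S}$ is multiplicative (respectively weakly multiplicative, respectively premultiplicative), then so is its telescopic extension $\mathcal{T}\mathfrak{S}$. Thus $\mathcal{T}$ restricts to extension maps $\mathcal{T}:\mathbf{MSum}\to\mathbf{MSum}$, $\mathcal{T}:\mathbf{wMSum}\to\mathbf{wMSum}$ and $\mathcal{T}:\mathbf{pMSum}\to\mathbf{pMSum}$.
   Context: Let $R$ be a commutative unital ring with $0\neq 1$ and $E$ a commutative unital $R$-algebra with $0\neq 1$. A *summation on $R$ to $E$* is a tuple $(R,E,D,\mathfrak{S})$, abbreviated $(D,\mathfrak{S})$ or $\mathfrak{S}$, where $D$ is a set and $\mathfrak{S}:D\to E$ a map such that: (I) $R[\sigma]\subseteq D\subseteq R[[\sigma]]$; (II) $D$ is an $R$-module and $\mathfrak{S}$ is an $R$-module homomorphism; (III) $\mathfrak{S}(1)=1$; (IV) $(1-\sigma)D\subseteq D$ and $\mathfrak{S}$ factors through $D/(1-\sigma)D$ (i.e. $\mathfrak{S}((1-\sigma)X)=0$ for all $X\in D$). For summations $(D,\mathfrak{S})$, $(D',\mathfrak{S}')$ on the same $R$ to the same $E$, $\mathfrak{S}'$ *extends* $\mathfrak{S}$, written $\mathfrak{S}\subseteq\mathfrak{S}'$, if $D\subseteq D'$ and $\mathfrak{S}'|_D=\mathfrak{S}$. $\mathbf{Sum}$ is the posetal category whose objects are all summations and whose morphisms are extensions. A summation $(D,\mathfrak{S})$ is *premultiplicative* if for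 all $n$ and all $A_1,\dots,A_n\in D$ such that $\prod_{j=1}^n A_j\in D$ we have $\prod_{j=1}^n\mathfrak{S}(A_j)=\mathfrak{S}\bigl(\prod_{j=1}^n A_j\bigr)$. It is *multiplicative* if moreover $A_1,\dots,A_n\in D$ always implies $\prod_j A_j\in D$ (equivalently, $D$ is an $R$-algebra and $\mathfrak{S}$ an $R$-algebra homomorphism). It is *weakly multiplicative* if it has an extension which is multiplicative. $\mathbf{MSum}$, $\mathbf{wMSum}$, $\mathbf{pMSum}$ are the full subcategories of $\mathbf{Sum}$ on the multiplicative, weakly multiplicative, and premultiplicative summations respectively. A functor $\mathcal{F}$ from one of these categories to itself is an *extension map* if $\mathcal{F}\mathfrak{S}\supseteq\mathfrak{S}$ for every object $\mathfrak{S}$. $\mathrm{Reg}(E)$ is the set of regular elements (non-zerodivisors) of $E$. The *telescopic extension* $(\mathcal{T}D,\mathcal{T}\mathfrak{S})$ of a summation $(D,\mathfrak{S})$ on $R$ to $E$: $X\in R[[\sigma]]$ belongs to $\mathcal{T}D$ iff there exist $A\in D$, $F\in R[\sigma]$, $f\in\mathrm{Reg}(E)$, $x\in E$ with $A=FX$, $\mathfrak{S}(F)=f$ and $\mathfrak{S}(A)=fx$; in that case $\mathcal{T}\mathfrak{S}(X):=x$. (This is a well-defined summation extending $\mathfrak{S}$.) *)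

(* Defs.v *)
From HB Require Import structures.
From mathcomp Require Import all_boot all_algebra.
From mathcomp Require Import boolp classical_sets.

Set Implicit Arguments.
Unset Strict Implicit.
Unset Printing Implicit Defensive.

Import GRing.Theory.
Local Open Scope ring_scope.

(* A wrapper around [nat -> R], so that the Cauchy product does not compete
   with the pointwise product of functions. *)
Record powerseries (R : Type) := PowerSeries { pscoef : nat -> R }.

Lemma powerseriesP (R : Type) (X Y : powerseries R) :
  pscoef X =1 pscoef Y -> X = Y.
Proof. by case: X Y => [f] [g] /= /funext ->. Qed.

HB.instance Definition _ (R : Type) := gen_eqMixin (powerseries R).
HB.instance Definition _ (R : Type) := gen_choiceMixin (powerseries R).

Section PowerSeriesRing.
Variable R : comNzRingType.
Implicit Types (X Y Z : powerseries R) (a b : R) (p q : {poly R}).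

Definition ps_of_poly p : powerseries R := PowerSeries (fun n => p`_n).

Definition ps_add X Y := PowerSeries (fun n => pscoef X n + pscoef Y n).
Definition ps_opp X := PowerSeries (fun n => - pscoef X n).
Definition ps_scale a X := PowerSeries (fun n => a * pscoef X n).
Definition ps_mul X Y :=
  PowerSeries (fun n => \sum_(i < n.+1) pscoef X i * pscoef Y (n - i)%N).

Fact ps_addA : associative ps_add.
Proof. by move=> X Y Z; apply: powerseriesP => n /=; rewrite addrA. Qed.
Fact ps_addC : commutative ps_add.
Proof. by move=> X Y; apply: powerseriesP => n /=; rewrite addrC. Qed.
Fact ps_add0 : left_id (ps_of_poly 0) ps_add.
Proof. by move=> X; apply: powerseriesP => n /=; rewrite coef0 add0r. Qed.
Fact ps_addN : left_inverse (ps_of_poly 0) ps_opp ps_add.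
Proof. by move=> X; apply: powerseriesP => n /=; rewrite addNr coef0. Qed.

HB.instance Definition _ :=
  GRing.isZmodule.Build (powerseries R) ps_addA ps_addC ps_add0 ps_addN.

Let trunc n X : {poly R} := \poly_(i < n.+1) pscoef X i.

Let coef_mul_trunc n k X Y : (k <= n)%N ->
  pscoef (ps_mul X Y) k = (trunc n X * trunc n Y)`_k.
Proof.
move=> kn; rewrite coefM; apply: eq_bigr => i _.
have ik : (i <= k)%N by rewrite -ltnS.
rewrite !coef_poly !ltnS (leq_trans ik kn).
by rewrite (leq_trans (leq_subr _ _) kn).
Qed.

Fact ps_mulA : associative ps_mul.
Proof.
move=> X Y Z; apply: powerseriesP => n.
transitivity ((trunc n X * (trunc n Y * trunc n Z))`_n).
  rewrite /= coefM; apply: eq_bigr => i _.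
  have := @coef_mul_trunc n (n - i)%N Y Z (leq_subr _ _) => /= <-.
  by rewrite coef_poly ltn_ord.
rewrite mulrA /= coefM; apply: eq_bigr => i _.
have ilen : (i <= n)%N by rewrite -ltnS.
rewrite -(@coef_mul_trunc n i X Y) //.
by rewrite coef_poly ltnS leq_subr.
Qed.

Fact ps_mulC : commutative ps_mul.
Proof.
move=> X Y; apply: powerseriesP => n.
by rewrite !(@coef_mul_trunc n) // mulrC.
Qed.

Fact ps_mul1 : left_id (ps_of_poly 1) ps_mul.
Proof.
move=> X; apply: powerseriesP => n /=.
rewrite big_ord_recl big1 ?addr0 /= ?coef1 ?mul1r ?subn0 // => i _.
by rewrite coef1 mul0r.
Qed.

Fact ps_mulD : left_distributive ps_mul +%R.
Proof.
move=> X Y Z; apply: powerseriesP => n /=.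
by rewrite -big_split /=; apply: eq_bigr => i _; rewrite mulrDl.
Qed.

Fact ps_one_neq0 : ps_of_poly 1 != 0.
Proof.
apply/eqP => /(congr1 (@pscoef R ^~ 0%N)) /= /eqP.
by rewrite coef1 coef0 oner_eq0.
Qed.

HB.instance Definition _ :=
  GRing.Zmodule_isComNzRing.Build (powerseries R)
    ps_mulA ps_mulC ps_mul1 ps_mulD ps_one_neq0.

Fact ps_scaleA a b X : ps_scale a (ps_scale b X) = ps_scale (a * b) X.
Proof. by apply: powerseriesP => n /=; rewrite mulrA. Qed.
Fact ps_scale1 : left_id 1 ps_scale.
Proof. by move=> X; apply: powerseriesP => n /=; rewrite mul1r. Qed.
Fact ps_scaleDr : right_distributive ps_scale +%R.
Proof. by move=> a X Y; apply: powerseriesP => n /=; rewrite mulrDr. Qed.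
Fact ps_scaleDl X : {morph ps_scale^~ X : a b / a + b}.
Proof. by move=> a b; apply: powerseriesP => n /=; rewrite mulrDl. Qed.

HB.instance Definition _ :=
  GRing.Zmodule_isLmodule.Build R (powerseries R)
    ps_scaleA ps_scale1 ps_scaleDr ps_scaleDl.

Fact ps_scaleAl a X Y : a *: (X * Y) = (a *: X) * Y.
Proof.
apply: powerseriesP => n /=; rewrite mulr_sumr.
by apply: eq_bigr => i _; rewrite mulrA.
Qed.

HB.instance Definition _ :=
  GRing.Lmodule_isLalgebra.Build R (powerseries R) ps_scaleAl.
HB.instance Definition _ :=
  GRing.Lalgebra_isComAlgebra.Build R (powerseries R).

Fact ps_of_poly_zmod : zmod_morphism ps_of_poly.
Proof. by move=> p q; apply: powerseriesP => n /=; rewrite coefB. Qed.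
HB.instance Definition _ :=
  GRing.isZmodMorphism.Build {poly R} (powerseries R) ps_of_poly
    ps_of_poly_zmod.

Fact ps_of_poly_monoid : monoid_morphism ps_of_poly.
Proof. by split=> // p q; apply: powerseriesP => n /=; rewrite coefM. Qed.
HB.instance Definition _ :=
  GRing.isMonoidMorphism.Build {poly R} (powerseries R) ps_of_poly
    ps_of_poly_monoid.

Fact ps_of_poly_scalable : scalable ps_of_poly.
Proof. by move=> a p; apply: powerseriesP => n /=; rewrite coefZ. Qed.
HB.instance Definition _ :=
  GRing.isScalable.Build R {poly R} (powerseries R) *:%R ps_of_poly
    ps_of_poly_scalable.

End PowerSeriesRing.

Notation sigma := (ps_of_poly 'X).

(* The map is defined on the domain only, i.e. on the subtype of [sdom], so
   that two summations are equal as soon as they have the same domain and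
   take the same values there.  Equations such as [val Z = a *: val X + val Y]
   between elements [X Y Z] of the subtype avoid naming membership proofs. *)
Record summation (R : comNzRingType) (E : comAlgType R) := Summation {
  sdom : set (powerseries R);
  smap :> sdom -> E;
  sdom_poly : forall F : {poly R}, ps_of_poly F \in sdom;
  sdom_submod : submod_closed (mem sdom);
  smap_linear : forall (a : R) (X Y Z : sdom),
    val Z = a *: val X + val Y -> smap Z = a *: smap X + smap Y;
  smap1 : forall X : sdom, val X = 1 -> smap X = 1;
  sdom_shift : forall X, X \in sdom -> (1 - sigma) * X \in sdom;
  smap_shift : forall X Y : sdom,
    val Y = (1 - sigma) * val X -> smap Y = 0
}.

Definition in_sdom (R : comNzRingType) (E : comAlgType R) (S : summation E)
    (X : powerseries R) (XD : X \in sdom S) : sdom S :=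
  exist _ X XD.

Definition poly_in_sdom (R : comNzRingType) (E : comAlgType R)
    (S : summation E) (F : {poly R}) : sdom S :=
  in_sdom (sdom_poly S F).

Definition extends (R : comNzRingType) (E : comAlgType R)
    (S S' : summation E) : Prop :=
  (sdom S `<=` sdom S')%classic /\
  forall (X : sdom S) (X' : sdom S'), val X' = val X -> S' X' = S X.

Definition is_premultiplicative (R : comNzRingType) (E : comAlgType R)
    (S : summation E) : Prop :=
  forall (n : nat) (A : 'I_n -> sdom S) (P : sdom S),
    val P = \prod_(j < n) val (A j) -> \prod_(j < n) S (A j) = S P.

Definition is_multiplicative (R : comNzRingType) (E : comAlgType R)
    (S : summation E) : Prop :=
  is_premultiplicative S /\
  forall (n : nat) (A : 'I_n -> sdom S), \prod_(j < n) val (A j) \in sdom S.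

Definition is_weakly_multiplicative (R : comNzRingType) (E : comAlgType R)
    (S : summation E) : Prop :=
  exists S' : summation E, extends S S' /\ is_multiplicative S'.

Section Telescopic.
Variables (R : comNzRingType) (E : comAlgType R) (S : summation E).
Implicit Types (X Y : powerseries R) (F : {poly R}).

(* [GRing.lreg f]: multiplication by [f] is injective, i.e. [f] is a
   non-zerodivisor of the commutative ring [E]. *)
Definition telescopes X (x : E) : Prop :=
  exists (A : sdom S) F (f : E),
    [/\ val A = ps_of_poly F * X, S (poly_in_sdom S F) = f,
        GRing.lreg f & S A = f * x].

Definition tele_dom : set (powerseries R) :=
  [set X | exists x, telescopes X x]%classic.

(* Independent of the choice of [x], see [tele_mapE]. *)
Definition tele_map (X : tele_dom) : E := sval (cid (set_mem (valP X))).

Let smapD (X Y Z : sdom S) : val Z = val X + val Y -> S Z = S X + S Y.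
Proof. by move=> h; rewrite (@smap_linear _ _ S 1 X Y) ?scale1r. Qed.

Let smap0 (X : sdom S) : val X = 0 -> S X = 0.
Proof.
move=> h; have := @smapD X X X; rewrite h addr0 => /(_ erefl) /eqP.
by rewrite -subr_eq subrr eq_sym => /eqP.
Qed.

Let zeroS : sdom S := in_sdom (proj1 (sdom_submod S)).

Let smapZ a (X Z : sdom S) : val Z = a *: val X -> S Z = a *: S X.
Proof.
move=> h; rewrite (@smap_linear _ _ S a X zeroS); last by rewrite h addr0.
by rewrite (smap0 (X := zeroS)) // addr0.
Qed.

Let sdomL a X Y : X \in sdom S -> Y \in sdom S -> a *: X + Y \in sdom S.
Proof. by move=> ? ?; apply: (proj2 (sdom_submod S)). Qed.

Let one_poly : ps_of_poly (1 : {poly R}) = 1. Proof. by rewrite rmorph1. Qed.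

Let smap_sigma (X Y : sdom S) : val Y = sigma * val X -> S Y = S X.
Proof.
move=> h; have Zin := sdom_shift (valP X).
pose Z : sdom S := in_sdom Zin.
have Z0 : S Z = 0 by apply: (@smap_shift _ _ S X).
by rewrite (@smapD Z Y X) ?Z0 ?add0r //= h mulrBl mul1r subrK.
Qed.

Let sdom_sigma X : X \in sdom S -> sigma * X \in sdom S.
Proof.
move=> XD; have := sdomL (-1) (sdom_shift XD) XD.
by rewrite scaleN1r mulrBl mul1r opprB subrK.
Qed.

Let smap_polyM F (A : sdom S) :
  exists2 B : sdom S, val B = ps_of_poly F * val A & S B = F.[1] *: S A.
Proof.
elim/poly_ind: F => [|F c [B hB SB]].
  by exists zeroS; rewrite ?rmorph0 ?mul0r // smap0 // horner0 scale0r.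
pose B1 : sdom S := in_sdom (sdom_sigma (valP B)).
have SB1 : S B1 = S B by apply: smap_sigma.
pose B2 : sdom S := in_sdom (sdomL c (valP A) (valP B1)).
exists B2.
  rewrite /= hB rmorphD rmorphM /= mulrDl -[c%:P]alg_polyC linearZ /= one_poly.
  by rewrite -scalerAl mul1r addrC mulrCA mulrA.
rewrite (@smap_linear _ _ S c A B1 B2) // SB1 SB.
by rewrite hornerMXaddC mulr1 scalerDl addrC.
Qed.

Let smap_polyME F (A B : sdom S) :
  val B = ps_of_poly F * val A -> S B = F.[1] *: S A.
Proof. move=> h; have [B' h' <-] := smap_polyM F A.
by congr (S _); apply: val_inj; rewrite h h'. Qed.

Let smap_poly F : S (poly_in_sdom S F) = F.[1]%:A.
Proof.
rewrite (@smap_polyME F (poly_in_sdom S 1)).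
  by rewrite (smap1 (X := poly_in_sdom S 1)) //= one_poly.
by rewrite /= one_poly mulr1.
Qed.

Let telescopesP X x :
  telescopes X x <-> exists (A : sdom S) F,
    [/\ val A = ps_of_poly F * X, GRing.lreg (F.[1]%:A : E)
      & S A = F.[1] *: x].
Proof.
split=> [[A [F [f [h1 <- h3 h4]]]]|[A [F [h1 h2 h3]]]].
  by exists A, F; rewrite h4 smap_poly mulr_algl in h3 *; split.
exists A, F, (S (poly_in_sdom S F)).
by rewrite smap_poly mulr_algl; split.
Qed.

Lemma telescopes_uniq X x y : telescopes X x -> telescopes X y -> x = y.
Proof.
move=> /telescopesP[A [F [hA rF SA]]] /telescopesP[B [G [hB rG SB]]].
have [A' hA' SA'] := smap_polyM G A.
have [B' hB' SB'] := smap_polyM F B.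
have AB : A' = B' by apply: val_inj; rewrite hA' hB' hA hB mulrCA.
apply: rF; apply: rG; rewrite !mulr_algl -SA -SA' AB SB' SB.
by rewrite !scalerA mulrC.
Qed.

Lemma tele_mapE (X : tele_dom) x : telescopes (val X) x -> tele_map X = x.
Proof. by apply: telescopes_uniq; rewrite /tele_map; case: cid. Qed.

Lemma tele_mapP (X : tele_dom) : telescopes (val X) (tele_map X).
Proof. by rewrite /tele_map; case: cid. Qed.

Lemma telescopes_sub (A : sdom S) : telescopes (val A) (S A).
Proof.
apply/telescopesP; exists A, 1.
by rewrite one_poly mul1r hornerC !scale1r; split=> //; apply: lreg1.
Qed.

Lemma telescopes_linear a X Y x y :
  telescopes X x -> telescopes Y y -> telescopes (a *: X + Y) (a *: x + y).
Proof.
move=> /telescopesP[A [F [hA rF SA]]] /telescopesP[B [G [hB rG SB]]].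
have [A' hA' SA'] := smap_polyM G A.
have [B' hB' SB'] := smap_polyM F B.
apply/telescopesP.
exists (in_sdom (sdomL a (valP A') (valP B'))), (F * G); split.
- rewrite /= hA' hB' hA hB rmorphM /= mulrDr -scalerAr.
  by rewrite mulrCA mulrA mulrA.
- by rewrite hornerM -scalerA -mulr_algl; apply: lregM.
- rewrite (@smap_linear _ _ S a A' B') // SA' SB' SA SB hornerM.
  by rewrite scalerDr !scalerA; congr (_ *: _ + _); rewrite mulrC (mulrC G.[1]).
Qed.

Lemma telescopes_shift X x : telescopes X x -> telescopes ((1 - sigma) * X) 0.
Proof.
move=> /telescopesP[A [F [hA rF SA]]]; apply/telescopesP.
exists (in_sdom (sdom_shift (valP A))), F; split=> //.
  by rewrite /= hA mulrCA.
by rewrite scaler0; apply: (@smap_shift _ _ S A).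
Qed.

Fact tele_dom_poly F : ps_of_poly F \in tele_dom.
Proof.
by apply/mem_set; exists (S (poly_in_sdom S F));
  apply: (telescopes_sub (poly_in_sdom S F)).
Qed.

Fact tele_dom_submod : submod_closed (mem tele_dom).
Proof.
split=> [|a X Y XD YD].
  by apply/mem_set; exists (S zeroS); apply: (telescopes_sub zeroS).
have [x Xx] := set_mem XD; have [y Yy] := set_mem YD.
by apply/mem_set; exists (a *: x + y); apply: telescopes_linear.
Qed.

Fact tele_map_linear a (X Y Z : tele_dom) :
  val Z = a *: val X + val Y -> tele_map Z = a *: tele_map X + tele_map Y.
Proof.
by move=> h; apply: tele_mapE; rewrite h; apply: telescopes_linear;
  apply: tele_mapP.
Qed.

Fact tele_map1 (X : tele_dom) : val X = 1 -> tele_map X = 1.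
Proof.
move=> h; apply: tele_mapE; rewrite h.
have := telescopes_sub (poly_in_sdom S 1).
by rewrite smap_poly hornerC scale1r /= one_poly.
Qed.

Fact tele_dom_shift X : X \in tele_dom -> (1 - sigma) * X \in tele_dom.
Proof.
move=> /set_mem[x Xx]; apply/mem_set; exists 0.
exact: telescopes_shift Xx.
Qed.

Fact tele_map_shift (X Y : tele_dom) :
  val Y = (1 - sigma) * val X -> tele_map Y = 0.
Proof.
move=> h; apply: tele_mapE; rewrite h.
exact: telescopes_shift (tele_mapP X).
Qed.

Definition telescopic : summation E :=
  Summation tele_dom_poly tele_dom_submod tele_map_linear tele_map1
    tele_dom_shift tele_map_shift.

End Telescopic.

Record Sum := SumObj {
  sum_ring : comNzRingType;
  sum_alg : comAlgType sum_ring;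
  sum_val :> summation sum_alg
}.

(* Extension between summations that are on the same ring to the same
   algebra. *)
Inductive sum_le : Sum -> Sum -> Prop :=
  SumLe (R : comNzRingType) (E : comAlgType R) (S S' : summation E) :
    extends S S' -> sum_le (SumObj S) (SumObj S').

Lemma extends_refl (R : comNzRingType) (E : comAlgType R) (S : summation E) :
  extends S S.
Proof. by split=> // X X' /val_inj ->. Qed.

Lemma extends_trans (R : comNzRingType) (E : comAlgType R)
    (S1 S2 S3 : summation E) :
  extends S1 S2 -> extends S2 S3 -> extends S1 S3.
Proof.
move=> [s12 e12] [s23 e23]; split=> [X /s12/s23//|X X' h].
have X2 : val X \in sdom S2 by apply/mem_set/s12/set_mem/valP.
by rewrite (e23 (in_sdom X2) X') // (e12 X).
Qed.

Lemma extends_anti (R : comNzRingType) (E : comAlgType R)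
    (S S' : summation E) :
  extends S S' -> extends S' S -> S = S'.
Proof.
case: S S' => [D f p1 p2 p3 p4 p5 p6] [D' f' p1' p2' p3' p4' p5' p6'].
rewrite /extends /= => -[s e] [s' _].
have DD : D = D' by apply/seteqP.
move: p1' p2' p3' p4' p5' p6' e; case: _ / DD f' {s s'}.
move=> f' p1' p2' p3' p4' p5' p6' e.
have ff : f = f' by apply/funext => X; rewrite (e X X).
case: _ / ff p1' p2' p3' p4' p5' p6' {e} => *.
by congr Summation; apply: Prop_irrelevance.
Qed.

Lemma sum_le_refl (s : Sum) : sum_le s s.
Proof. by case: s => R E S; constructor; apply: extends_refl. Qed.

Fact sum_leEr (s1 s2 : Sum) : sum_le s1 s2 ->
  exists2 S : summation (sum_alg s1), s2 = SumObj S & extends s1 S.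
Proof. by case=> R E S S' h; exists S'. Qed.

Fact sum_leEl (s1 s2 : Sum) : sum_le s1 s2 ->
  exists2 S : summation (sum_alg s2), s1 = SumObj S & extends S s2.
Proof. by case=> R E S S' h; exists S. Qed.

Lemma sum_le_trans (s1 s2 s3 : Sum) :
  sum_le s1 s2 -> sum_le s2 s3 -> sum_le s1 s3.
Proof.
move=> /sum_leEl[S1 -> h1] /sum_leEr[S3 -> h3].
by constructor; apply: extends_trans h3.
Qed.

Lemma SumObj_inj (R : comNzRingType) (E : comAlgType R) (S S' : summation E) :
  SumObj S = SumObj S' -> S = S'.
Proof.
move=> eqS.
pose alg := {A : comNzRingType & comAlgType A}.
pose mk (A : comNzRingType) (B : comAlgType A) : alg := existT _ A B.
have : forall s, SumObj S = s ->
    exists q : mk R E = mk (sum_ring s) (sum_alg s),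
      @eq_rect alg (mk R E) (fun e => @summation (projT1 e) (projT2 e)) S _ q
        = sum_val s.
  by move=> s <-; exists erefl.
by move=> /(_ _ eqS) /= [q]; rewrite (Prop_irrelevance q erefl).
Qed.

Lemma sum_le_anti (s1 s2 : Sum) : sum_le s1 s2 -> sum_le s2 s1 -> s1 = s2.
Proof.
case: s2 => R E S2 /sum_leEl[/= S1 -> h12] /sum_leEr[/= S /SumObj_inj <- h21].
by rewrite (extends_anti h12 h21).
Qed.

(* Since there is at most one morphism between two objects of a posetal
   category, a functor is a monotone map on objects. *)
Definition full_sub (P : Sum -> Prop) := {s : Sum | P s}.

Record extension_map (P : Sum -> Prop) := ExtensionMap {
  emap :> full_sub P -> full_sub P;
  emap_functor : forall s s' : full_sub P,
    sum_le (sval s) (sval s') -> sum_le (sval (emap s)) (sval (emap s'));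
  emap_extends : forall s : full_sub P, sum_le (sval s) (sval (emap s))
}.

Definition restricts_to_extension_map (T : Sum -> Sum) (P : Sum -> Prop) :=
  exists F : extension_map P, forall s : full_sub P, sval (F s) = T (sval s).

Definition MSum (s : Sum) : Prop := is_multiplicative s.
Definition wMSum (s : Sum) : Prop := is_weakly_multiplicative s.
Definition pMSum (s : Sum) : Prop := is_premultiplicative s.

Definition Telescopic (s : Sum) : Sum := SumObj (telescopic s).

(* Main.v *)
Require Import Defs.
From mathcomp Require Import all_boot all_algebra.
From mathcomp Require Import boolp classical_sets.

Set Implicit Arguments.
Unset Strict Implicit.
Unset Printing Implicit Defensive.

Import GRing.Theory.
Local Open Scope ring_scope.

(** Let [X_1, ..., X_n] and [P = X_1 ... X_n] have telescopic sums [x_j] and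
    [p], witnessed by [A_j = F_j X_j] and [A = F P].  Then
    [(F_1 ... F_n) A = F A_1 ... A_n] lies in [D], and premultiplicativity
    evaluates its sum in two ways:
    [(f_1 ... f_n) f p = f (f_1 x_1) ... (f_n x_n)].  As [f] and the [f_j] are
    regular, [p = x_1 ... x_n].  In the multiplicative case [F_1 ... F_n] and
    [A_1 ... A_n] witness that [P] has a telescopic sum.  The weakly
    multiplicative case follows because the telescopic extension is
    monotone. *)

Lemma lreg_prod (E : comNzRingType) (I : finType) (f : I -> E) :
  (forall i, GRing.lreg (f i)) -> GRing.lreg (\prod_i f i).
Proof.
by move=> rf; apply: big_ind => [|x y|i _]; [apply: lreg1|apply: lregM|].
Qed.

Section Summation.
Variables (R : comNzRingType) (E : comAlgType R).
Implicit Types S : summation E.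

(** Induction on the Horner form of [F], once the domain is known to be closed under multiplication
    by [sigma]. *)
Lemma sdom_polyM S (F : {poly R}) (X : powerseries R) :
  X \in sdom S -> ps_of_poly F * X \in sdom S.
Proof.
move=> XD; have [D0 DL] := sdom_submod S.
elim/poly_ind: F => [|F c FX]; first by rewrite rmorph0 mul0r.
have sFX : sigma * (ps_of_poly F * X) \in sdom S.
  (* With [Y = F X], closure under [sigma] comes from [sigma Y = Y - (1 - sigma) Y]. *)
  have := DL (-1) _ _ (sdom_shift FX) FX.
  by rewrite scaleN1r mulrBl mul1r opprB subrK.
have := DL c _ _ XD sFX.
rewrite rmorphD rmorphM /= mulrDl -[c%:P]alg_polyC linearZ /= rmorph1.
by rewrite -scalerAl mul1r addrC mulrA (mulrC (ps_of_poly F)).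
Qed.

(** The product of the [B j] alone need not lie in the domain, so the binary rule cannot be
    iterated. Instead premultiplicativity is applied once, to the family of length [n.+1] with [A]
    at index 0 and [B] after it. *)
Lemma premultiplicative_cons S n (A : sdom S) (B : 'I_n -> sdom S)
    (P : sdom S) :
  is_premultiplicative S -> val P = val A * \prod_(j < n) val (B j) ->
  S P = S A * \prod_(j < n) S (B j).
Proof.
move=> Sm hP; pose C (i : 'I_n.+1) := oapp B A (unlift ord0 i).
have C0 : C ord0 = A by rewrite /C unlift_none.
have CS i : C (lift ord0 i) = B i by rewrite /C liftK.
rewrite -(Sm _ C P) big_ord_recl C0; last first.
  by rewrite hP; congr (_ * _); apply: eq_bigr => i _; rewrite CS.
by congr (_ * _); apply: eq_bigr => i _; rewrite CS.
Qed.

Lemma premultiplicativeM S (A B P : sdom S) :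
  is_premultiplicative S -> val P = val A * val B -> S P = S A * S B.
Proof.
move=> Sm hP; rewrite (@premultiplicative_cons _ 1 A (fun=> B) P) //.
  by rewrite big_ord1.
by rewrite big_ord1.
Qed.

Lemma premultiplicative_poly_prod S n (F : 'I_n -> {poly R}) :
  is_premultiplicative S ->
  S (poly_in_sdom S (\prod_j F j)) = \prod_j S (poly_in_sdom S (F j)).
Proof. by move=> Sm; apply/esym/Sm; rewrite /= rmorph_prod. Qed.

(** Choice selects the witnesses of all factors at once; each regular value [f] is replaced by the
    sum of its polynomial. *)
Lemma telescopes_family S n (X : 'I_n -> powerseries R) (x : 'I_n -> E) :
  (forall j, telescopes S (X j) (x j)) ->
  exists (A : 'I_n -> sdom S) (F : 'I_n -> {poly R}),
    [/\ forall j, val (A j) = ps_of_poly (F j) * X j,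
        forall j, GRing.lreg (S (poly_in_sdom S (F j)))
      & forall j, S (A j) = S (poly_in_sdom S (F j)) * x j].
Proof.
move=> hX; have [] := @choice _ _ (fun j (AF : sdom S * {poly R}) =>
  [/\ val AF.1 = ps_of_poly AF.2 * X j,
      GRing.lreg (S (poly_in_sdom S AF.2))
    & S AF.1 = S (poly_in_sdom S AF.2) * x j]).
  by move=> j; have [A [F [f [? <- ? ?]]]] := hX j; exists (A, F).
by move=> AF h; exists (fun j => (AF j).1), (fun j => (AF j).2);
  split=> j; case: (h j).
Qed.

Lemma telescopes_prod_uniq S n (X : 'I_n -> powerseries R) (x : 'I_n -> E)
    (p : E) :
  is_premultiplicative S -> (forall j, telescopes S (X j) (x j)) ->
  telescopes S (\prod_j X j) p -> \prod_j x j = p.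
Proof.
move=> Sm /telescopes_family[A [F [hA rF SA]]] [B [G [_ [hB <- rG SB]]]].
(* [C] equals both [(\prod_j F j) B] and [G \prod_j A j]. The first form shows that it lies in the
   domain, although [\prod_j A j] may not. *)
pose C := in_sdom (sdom_polyM (\prod_j F j) (valP B)).
have SC1 : S C = S (poly_in_sdom S (\prod_j F j)) * S B.
  exact: premultiplicativeM.
have SC2 : S C = S (poly_in_sdom S G) * \prod_j S (A j).
  apply: premultiplicative_cons => //=.
  rewrite hB (eq_bigr _ (fun j _ => hA j)) big_split /= rmorph_prod.
  by rewrite mulrCA.
(* Regularity allows both sides to be multiplied by the sums of the [F j] and of [G]; each side then
   equals [S C]. *)
apply: (lreg_prod rF); apply: rG.
rewrite -big_split -(eq_bigr _ (fun j _ => SA j)) -SC2 SC1 SB.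
by rewrite premultiplicative_poly_prod // mulrCA.
Qed.

(** Closure of the domain under products makes [\prod_j A j] available as a witness, so existence of
    the sum is now a conclusion. *)
Lemma telescopes_prod S n (X : 'I_n -> powerseries R) (x : 'I_n -> E) :
  is_multiplicative S -> (forall j, telescopes S (X j) (x j)) ->
  telescopes S (\prod_j X j) (\prod_j x j).
Proof.
move=> [Sm SD] /telescopes_family[A [F [hA rF SA]]].
exists (in_sdom (SD n A)), (\prod_j F j), (\prod_j S (poly_in_sdom S (F j))).
split.
- by rewrite /= rmorph_prod -big_split; apply: eq_bigr => j _; apply: hA.
- exact: premultiplicative_poly_prod.
- exact: lreg_prod.
- by rewrite -(Sm n A) // -big_split; apply: eq_bigr => j _; apply: SA.
Qed.

Lemma telescopic_premultiplicative S :
  is_premultiplicative S -> is_premultiplicative (telescopic S).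
Proof.
move=> Sm n X P hP; apply: (telescopes_prod_uniq Sm (fun j => tele_mapP (X j))).
by rewrite -hP; apply: tele_mapP.
Qed.

Lemma telescopic_multiplicative S :
  is_multiplicative S -> is_multiplicative (telescopic S).
Proof.
move=> Sm; split=> [|n X]; first by case: Sm => /telescopic_premultiplicative.
apply/mem_set; exists (\prod_j telescopic S (X j)).
by apply: telescopes_prod => // j; apply: tele_mapP.
Qed.

(** The same witnesses serve for [S'], which agrees with [S] on both [A] and [F]. *)
Lemma extends_telescopes S S' X x :
  extends S S' -> telescopes S X x -> telescopes S' X x.
Proof.
move=> [sub eqS] [A [F [f [hA Sf rf SA]]]].
have A' : val A \in sdom S' by apply/mem_set/sub/set_mem/valP.
exists (in_sdom A'), F, f; split=> //.
  by rewrite -Sf; apply: eqS.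
by rewrite -SA; apply: eqS.
Qed.

(** Agreement of values follows from uniqueness of telescopic sums in [S']. This gives both
    functoriality and the weakly multiplicative case. *)
Lemma telescopic_extends S S' :
  extends S S' -> extends (telescopic S) (telescopic S').
Proof.
move=> SS'; split=> [X [x hx]|X X' h].
  by exists x; apply: extends_telescopes hx.
by apply: tele_mapE; rewrite h; apply: extends_telescopes (tele_mapP X).
Qed.

Lemma extends_telescopic S : extends S (telescopic S).
Proof.
split=> [X /mem_set XD|X X' h].
  by exists (S (in_sdom XD)); apply: (telescopes_sub (in_sdom XD)).
by apply: tele_mapE; rewrite h; apply: telescopes_sub.
Qed.

Lemma telescopic_weakly_multiplicative S :
  is_weakly_multiplicative S -> is_weakly_multiplicative (telescopic S).
Proof.
move=> [S' [SS' Sm]]; exists (telescopic S'); split.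
  exact: telescopic_extends.
exact: telescopic_multiplicative.
Qed.

End Summation.

Lemma Telescopic_le s s' : sum_le s s' -> sum_le (Telescopic s) (Telescopic s').
Proof. by case=> R E S S' SS'; constructor; apply: telescopic_extends. Qed.

Lemma Telescopic_restricts (P : Sum -> Prop) :
  (forall s, P s -> P (Telescopic s)) ->
  restricts_to_extension_map Telescopic P.
Proof.
move=> PT.
pose T (s : full_sub P) : full_sub P := exist _ _ (PT _ (svalP s)).
have mono s s' : sum_le (sval s) (sval s') -> sum_le (sval (T s)) (sval (T s')).
  exact: Telescopic_le.
have ext s : sum_le (sval s) (sval (T s)).
  (* Destructing the object exposes the ring and algebra shared by both summations, as the
     constructor of [sum_le] requires. *)
  by case: s => -[R E S] Ps; constructor; apply: extends_telescopic.
by exists (ExtensionMap mono ext).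
Qed.

Theorem proposition3p12 :
  (forall (R : comNzRingType) (E : comAlgType R) (S : summation E),
     [/\ is_multiplicative S -> is_multiplicative (telescopic S),
         is_weakly_multiplicative S -> is_weakly_multiplicative (telescopic S)
       & is_premultiplicative S -> is_premultiplicative (telescopic S)]) /\
  [/\ restricts_to_extension_map Telescopic MSum,
      restricts_to_extension_map Telescopic wMSum
    & restricts_to_extension_map Telescopic pMSum].
Proof.
split=> [R E S|]; split.
- exact: telescopic_multiplicative.
- exact: telescopic_weakly_multiplicative.
- exact: telescopic_premultiplicative.
- by apply: Telescopic_restricts => s; apply: telescopic_multiplicative.
- by apply: Telescopic_restricts => s; apply: telescopic_weakly_multiplicative.
- by apply: Telescopic_restricts => s; apply: telescopic_premultiplicative.
Qed.
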